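(* In the source coding problem with receiver side information described in the context, suppose $Y=(X,Z)$ for some random variable $Z$ on a finite set $\mathcal{Z}$ (i.e. $\mathcal{Y}=\mathcal{X}\times\mathcal{Z}$ and $Y_i=(X_i,Z_i)$), and suppose $(X,Z)\to U\to V$ forms a Markov chain. Then the set $\mathcal{R}$ of achievable rate triples equals the closure of $\bigcup_{p\in\mathcal{P}}\mathcal{R}_{out}^{(p)}$.
   Context: Let $\mathcal{X},\mathcal{Y},\mathcal{U},\mathcal{V}$ be finite sets and let $\{(X_i,Y_i,U_i,V_i)\}_{i\ge1}$ be i.i.d. with joint distribution $\mathcal{Q}_{XYUV}$. For $i=0,1,2$ let $\mathcal{M}_i=\{1,\dots,|\mathcal{M}_i|\}$ be finite index sets. A code of block length $n$ consists of an encoder $e^{(n)}:\mathcal{X}^n\times\mathcal{Y}^n\to\mathcal{M}_0\times\mathcal{M}_1\times\mathcal{M}_2$, $(M_0,M_1,M_2)=e^{(n)}(X^n,Y^n)$, a decoder $d_x^{(n)}:\mathcal{M}_0\times\mathcal{M}_1\times\mathcal{U}^n\to\mathcal{X}^n$, $\widehat X^n=d_x^{(n)}(M_0,M_1,U^n)$, and a decoder $d_y^{(n)}:\mathcal{M}_0\times\mathcal{M}_2\times\mathcal{V}^n\to\mathcal{Y}^n$, $\widehat Y^n=d_y^{(n)}(M_0,M_2,V^n)$. Let $P_e=\max\{\Pr[\widehat X^n\ne X^n],\Pr[\widehat Y^n\ne Y^n]\}$. A triple $(R_0,R_1,R_2)$ is achievable if for every $\epsilon>0$ and all sufficiently large $n$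 there is such a code with $P_e\le\epsilon$ and $(1/n)\log_2|\mathcal{M}_i|\le R_i+\epsilon$, $i=0,1,2$; $\mathcal{R}$ is the set of achievable triples. Let $\mathcal{W}$ be a finite set with $|\mathcal{W}|\le|\mathcal{X}||\mathcal{Y}|+3$, and let $\mathcal{P}$ be the family of probability functions $p$ on $\mathcal{W}\times\mathcal{X}\times\mathcal{Y}\times\mathcal{U}\times\mathcal{V}$ with $p(w,x,y,u,v)=p(w|x,y)p(x,y,u,v)$ and $\sum_w p(w,x,y,u,v)=\mathcal{Q}_{XYUV}(x,y,u,v)$. For $p\in\mathcal{P}$, with $J_p=\max\{I_p(X,Y;W|U),I_p(X,Y;W|V)\}$, let $\mathcal{R}_{out}^{(p)}$ be the set of $(R_0,R_1,R_2)$ with $R_0\ge J_p$, $R_0+R_1\ge J_p+H_p(X|W,U)$, $R_0+R_2\ge J_p+H_p(Y|W,V)$.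
   Formalization: The regions $\mathcal{R}_{out}^{(p)}$ are restricted to nonnegative rates $R_0,R_1,R_2\ge 0$; without this they contain triples with negative $R_1$ or $R_2$, which are never achievable, so the stated equality would fail. *)

(* Defs.v *)
From HB Require Import structures.
From mathcomp Require Import all_boot all_order all_algebra.
From mathcomp Require Import all_classical all_reals all_analysis.
Set Implicit Arguments. Unset Strict Implicit. Unset Printing Implicit Defensive.
Import Order.TTheory GRing.Theory Num.Theory.
Import numFieldNormedType.Exports.
Local Open Scope classical_set_scope.
Local Open Scope ring_scope.

Definition log2 {R : realType} (x : R) : R := ln x / ln 2.

Definition is_pmf {R : realType} {T : finType} (P : {ffun T -> R}) : Prop :=
  (forall t, 0 <= P t) /\ \sum_t P t = 1.

Definition marg {R : realType} {T : finType} {A : eqType}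
  (P : {ffun T -> R}) (f : T -> A) (a : A) : R :=
  \sum_(t | f t == a) P t.

Definition entropy {R : realType} {T A : finType}
  (P : {ffun T -> R}) (f : T -> A) : R :=
  - \sum_(a : A) (let q := marg P f a in if q == 0 then 0 else q * log2 q).

Definition cond_entropy {R : realType} {T A B : finType}
  (P : {ffun T -> R}) (f : T -> A) (g : T -> B) : R :=
  entropy P (fun t => (f t, g t)) - entropy P g.

Definition cond_mutinf {R : realType} {T A B C : finType}
  (P : {ffun T -> R}) (f : T -> A) (g : T -> B) (c : T -> C) : R :=
  cond_entropy P f c - cond_entropy P f (fun t => (g t, c t)).

Definition iid_prob {R : realType} {T : finType} (Q : {ffun T -> R}) (n : nat)
  (E : pred {ffun 'I_n -> T}) : R :=
  \sum_(s : {ffun 'I_n -> T} | E s) \prod_(i < n) Q (s i).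

Section Seqs.
Variables (X Y U V : finType) (n : nat).
Definition seqX (s : {ffun 'I_n -> X * Y * U * V}) : {ffun 'I_n -> X} :=
  [ffun i => (s i).1.1.1].
Definition seqY (s : {ffun 'I_n -> X * Y * U * V}) : {ffun 'I_n -> Y} :=
  [ffun i => (s i).1.1.2].
Definition seqU (s : {ffun 'I_n -> X * Y * U * V}) : {ffun 'I_n -> U} :=
  [ffun i => (s i).1.2].
Definition seqV (s : {ffun 'I_n -> X * Y * U * V}) : {ffun 'I_n -> V} :=
  [ffun i => (s i).2].
End Seqs.

(* The set R of achievable triples (R0, R1, R2) = ((R0, R1), R2).
   Message sets M_i are represented by 'I_(|M_i|). *)
Definition achievable_region {R : realType} {X Y U V : finType}
  (Q : {ffun X * Y * U * V -> R}) : set (R * R * R) :=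
  [set r | forall eps : R, 0 < eps -> exists N : nat, forall n : nat, (N <= n)%N ->
    exists (m0 m1 m2 : nat)
      (e : {ffun 'I_n -> X} -> {ffun 'I_n -> Y} -> 'I_m0 * 'I_m1 * 'I_m2)
      (dx : 'I_m0 -> 'I_m1 -> {ffun 'I_n -> U} -> {ffun 'I_n -> X})
      (dy : 'I_m0 -> 'I_m2 -> {ffun 'I_n -> V} -> {ffun 'I_n -> Y}),
      [/\ Num.max
            (iid_prob Q (fun s => let c := e (seqX s) (seqY s) in
                                  dx c.1.1 c.1.2 (seqU s) != seqX s))
            (iid_prob Q (fun s => let c := e (seqX s) (seqY s) in
                                  dy c.1.1 c.2 (seqV s) != seqY s)) <= eps,
          log2 (m0%:R : R) / n%:R <= r.1.1 + eps,
          log2 (m1%:R : R) / n%:R <= r.1.2 + eps &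
          log2 (m2%:R : R) / n%:R <= r.2 + eps]].

Definition Wset (X Y : finType) : finType := 'I_(#|X| * #|Y| + 3).

Definition is_channel {R : realType} {X Y W : finType}
  (k : {ffun X * Y -> {ffun W -> R}}) : Prop :=
  forall xy, is_pmf (k xy).

Definition joint_p {R : realType} {X Y U V W : finType}
  (Q : {ffun X * Y * U * V -> R}) (k : {ffun X * Y -> {ffun W -> R}})
  : {ffun W * X * Y * U * V -> R} :=
  [ffun t => k (t.1.1.1.2, t.1.1.2) t.1.1.1.1 *
             Q (t.1.1.1.2, t.1.1.2, t.1.2, t.2)].

Section Rout.
Variables (R : realType) (X Y U V W : finType).
Definition pW (t : W * X * Y * U * V) : W := t.1.1.1.1.
Definition pX (t : W * X * Y * U * V) : X := t.1.1.1.2.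
Definition pY (t : W * X * Y * U * V) : Y := t.1.1.2.
Definition pU (t : W * X * Y * U * V) : U := t.1.2.
Definition pV (t : W * X * Y * U * V) : V := t.2.
Definition pXY (t : W * X * Y * U * V) : X * Y := (pX t, pY t).
Definition pWU (t : W * X * Y * U * V) : W * U := (pW t, pU t).
Definition pWV (t : W * X * Y * U * V) : W * V := (pW t, pV t).

Definition Jp (p : {ffun W * X * Y * U * V -> R}) : R :=
  Num.max (cond_mutinf p pXY pW pU) (cond_mutinf p pXY pW pV).

Definition Rout (p : {ffun W * X * Y * U * V -> R}) : set (R * R * R) :=
  [set r | [/\ 0 <= r.1.1, 0 <= r.1.2, 0 <= r.2 /\
             Jp p <= r.1.1,
             Jp p + cond_entropy p pX pWU <= r.1.1 + r.1.2 &
             Jp p + cond_entropy p pY pWV <= r.1.1 + r.2]].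
End Rout.

Definition Rout_union {R : realType} {X Y U V : finType}
  (Q : {ffun X * Y * U * V -> R}) : set (R * R * R) :=
  [set r | exists k : {ffun X * Y -> {ffun Wset X Y -> R}},
             is_channel k /\ Rout (joint_p Q k) r].

(* Y = (X, Z): law of (X, (X,Z), U, V) from the law of (X, Z, U, V) *)
Definition lift_Y {R : realType} {X Z U V : finType}
  (Q : {ffun X * Z * U * V -> R}) : {ffun X * (X * Z) * U * V -> R} :=
  [ffun t => if t.1.1.2.1 == t.1.1.1
             then Q (t.1.1.1, t.1.1.2.2, t.1.2, t.2) else 0].

Definition markov_XZ_U_V {R : realType} {X Z U V : finType}
  (Q : {ffun X * Z * U * V -> R}) : Prop :=
  forall t : X * Z * U * V,
    Q t * marg Q (fun s => s.1.2) t.1.2 =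
    marg Q (fun s => s.1) t.1 * marg Q (fun s => (s.1.2, s.2)) (t.1.2, t.2).

(* Main.v *)
(** Taking [W] constant is optimal: by submodularity of entropy (nonnegativity
    of [I(Y;W|X,U)] and [I(X;W|Y,V)]),
    [J_p + H(X|W,U) >= H(X|U)] and [J_p + H(Y|W,V) >= H(Y|V)], with equality and
    [J_p = 0] for constant [W].  So the union of the outer regions is the closed
    cut-set region [R_i >= 0], [R0 + R1 >= H(X|U)], [R0 + R2 >= H(Y|V)].

    The cut-set region is achieved by Slepian-Wolf binning.  Split
    [R0 = s + t] with [s = min (R0, H(X|U))]; send the pair of a rate-[s] bin
    of [X^n] and a rate-[t] bin of [Y^n] as [M0], a rate-[R1] bin of [X^n] as [M1]
    and a rate-[R2] bin of [Y^n] as [M2].  A wrong [y'] with another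
    [X]-component collides at rate [R0 + R2 >= H(Y|V)], one with the same
    [X]-component at rate [t + R2 >= H(Y|X,V)]; the latter inequality follows from
    [H(X|U) <= H(X|V)], which is where the Markov chain enters.

    Conversely, given side information [b], a decoder outputs at most one sequence
    per message value, so the probability of correct decoding is at most that of
    having conditional probability above [th], plus [th] times the number of
    messages; the asymptotic equipartition property concludes. *)
Require Import Defs.
From HB Require Import structures.
From mathcomp Require Import all_boot all_order all_algebra.
From mathcomp Require Import all_classical all_reals all_analysis.
From mathcomp Require Import zify ring lra.
Import Order.TTheory GRing.Theory Num.Theory.
Import numFieldNormedType.Exports.
Set Implicit Arguments. Unset Strict Implicit. Unset Printing Implicit Defensive.
Local Open Scope ring_scope.

(** * Entropy and conditional probabilities *)

Section Prob.
Variables (R : realType) (T : finType) (P : {ffun T -> R}).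

Definition prob (E : pred T) : R := \sum_(t | E t) P t.

(** Grouping outcomes by the value of [f] turns entropy into an expectation, so that entropies of
    different maps can be compared under one sum. The case split on null values disappears because
    their weight is zero. *)
Lemma entropyE (A : finType) (f : T -> A) :
  entropy P f = - \sum_t P t * log2 (marg P f (f t)).
Proof.
rewrite /entropy; congr (- _); rewrite [RHS](partition_big f xpredT) //=.
apply: eq_bigr => a _.
rewrite [RHS](eq_bigr (fun t => P t * log2 (marg P f a))); last first.
  by move=> t /eqP ->.
by rewrite -mulr_suml; case: eqP => // H; rewrite -/(marg P f a) H mul0r.
Qed.

(** Entropy sees a map only through the partition it induces on the support. This serves to reorder
    tuples and to drop components that are constant or determined by the others. *)
Lemma entropy_ker (A B : finType) (f : T -> A) (g : T -> B) :
  (forall s t, P s != 0 -> P t != 0 -> (f s == f t) = (g s == g t)) ->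
  entropy P f = entropy P g.
Proof.
move=> fg; rewrite !entropyE; congr (- _); apply: eq_bigr => t _.
have [->|Pt] := eqVneq (P t) 0; first by rewrite !mul0r.
congr (_ * log2 _); rewrite /marg [LHS]big_mkcond [RHS]big_mkcond /=.
apply: eq_bigr => s _.
have [->|Ps] := eqVneq (P s) 0; first by rewrite !if_same.
by rewrite fg.
Qed.

Lemma sum_marg (A : finType) (f : T -> A) (h : A -> R) :
  \sum_t P t * h (f t) = \sum_a marg P f a * h a.
Proof.
rewrite (partition_big f xpredT) //=; apply: eq_bigr => a _.
by rewrite mulr_suml; apply: eq_bigr => t /eqP ->.
Qed.

Lemma sum_marg_pair (A B : finType) (f : T -> A) (g : T -> B) b :
  \sum_a marg P (fun t => (f t, g t)) (a, b) = marg P g b.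
Proof.
rewrite [RHS](partition_big f xpredT) //=; apply: eq_bigr => a _.
by apply: eq_bigl => t; rewrite xpair_eqE andbC.
Qed.

Lemma entropyB (A B : finType) (f : T -> A) (g : T -> B) :
  entropy P f - entropy P g =
  \sum_t P t * (log2 (marg P g (g t)) - log2 (marg P f (f t))).
Proof.
rewrite !entropyE opprK addrC -sumrB.
by apply: eq_bigr => t _; rewrite mulrBr.
Qed.

(** Since division by zero gives zero, the law conditioned on a null value of [g] is identically
    zero, hence only a subprobability. *)
Definition cprob (A B : finType) (f : T -> A) (g : T -> B) (a : A) (b : B) : R :=
  marg P (fun t => (f t, g t)) (a, b) / marg P g b.

Hypothesis pmfP : is_pmf P.

Lemma is_pmf_ge0 t : 0 <= P t. Proof. exact: pmfP.1. Qed.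

Lemma marg_ge0 (A : eqType) (f : T -> A) a : 0 <= marg P f a.
Proof. by apply: sumr_ge0 => t _; exact: is_pmf_ge0. Qed.

Lemma marg_gt0 (A : eqType) (f : T -> A) t : P t != 0 -> 0 < marg P f (f t).
Proof.
move=> Pt; rewrite /marg (bigD1 t) //= ltr_wpDr//; last by rewrite lt_def Pt is_pmf_ge0.
by apply: sumr_ge0 => s _; exact: is_pmf_ge0.
Qed.

Lemma prob_le (E F : pred T) :
  (forall t, P t != 0 -> E t -> F t) -> prob E <= prob F.
Proof.
move=> EF; rewrite /prob [leLHS]big_mkcond [leRHS]big_mkcond /=.
apply: ler_sum => t _.
have [->|Pt] := eqVneq (P t) 0; first by rewrite !if_same.
case: ifPn => [/(EF _ Pt) -> //|_]; case: ifP => // _; exact: is_pmf_ge0.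
Qed.

Lemma probU (E F : pred T) : prob (fun t => E t || F t) <= prob E + prob F.
Proof.
rewrite /prob [leLHS]big_mkcond [X in _ <= X + _]big_mkcond [X in _ <= _ +
  X]big_mkcond /=.
rewrite -big_split /=; apply: ler_sum => t _; have := is_pmf_ge0 t.
by case: (E t); case: (F t) => /= ?; lra.
Qed.

Lemma probC (E : pred T) : prob E + prob (fun t => ~~ E t) = 1.
Proof. by rewrite -pmfP.2 [RHS](bigID E). Qed.

Lemma cprob_ge0 (A B : finType) (f : T -> A) (g : T -> B) a b : 0 <= cprob f g a b.
Proof. by rewrite divr_ge0 ?marg_ge0. Qed.

Lemma cprob_gt0 (A B : finType) (f : T -> A) (g : T -> B) t :
  P t != 0 -> 0 < cprob f g (f t) (g t).
Proof.
by move=> Pt; rewrite divr_gt0 ?marg_gt0// (marg_gt0 (fun t => (f t, g t)) Pt).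
Qed.

Lemma sum_cprob (A B : finType) (f : T -> A) (g : T -> B) b :
  \sum_a cprob f g a b <= 1.
Proof.
rewrite -mulr_suml sum_marg_pair.
by have [->|nz] := eqVneq (marg P g b) 0; [rewrite mul0r | rewrite divff].
Qed.

(** Each counted value carries conditional mass at least [th], out of a total of at most one. This
    bounds the size of typical sets. *)
Lemma card_cprob (A B : finType) (f : T -> A) (g : T -> B) b (th : R) :
  #|[pred a | th <= cprob f g a b]|%:R * th <= 1.
Proof.
apply: le_trans (sum_cprob f g b); rewrite mulrC mulr_natr -sumr_const.
rewrite big_mkcond /=; apply: ler_sum => a _; rewrite inE.
by case: ifP => // _; exact: cprob_ge0.
Qed.

Lemma cond_entropyE (A B : finType) (f : T -> A) (g : T -> B) :
  cond_entropy P f g = \sum_t P t * - log2 (cprob f g (f t) (g t)).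
Proof.
rewrite /cond_entropy entropyB; apply: eq_bigr => t _.
have [->|Pt] := eqVneq (P t) 0; first by rewrite !mul0r.
rewrite /cprob /log2 ln_div ?posrE ?marg_gt0 ?(marg_gt0 (fun t => (f t, g t)) Pt)//.
by rewrite mulrBl opprB.
Qed.

(** This is [I(f;g|h) >= 0], obtained from [ln x <= x - 1] applied to a likelihood ratio whose
    expectation is at most one. *)
Lemma entropy_submod (A B C : finType) (f : T -> A) (g : T -> B) (h : T -> C) :
  entropy P (fun t => (f t, g t, h t)) + entropy P h <=
  entropy P (fun t => (f t, h t)) + entropy P (fun t => (g t, h t)).
Proof.
set F := fun t => (f t, g t, h t); set G := fun t => (f t, h t).
set K := fun t => (g t, h t).
rewrite -subr_le0.
have -> : entropy P F + entropy P h - (entropy P G + entropy P K) =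
  (entropy P F - entropy P G) + (entropy P h - entropy P K) by lra.
rewrite !entropyB -big_split /=.
have ln2 : 0 < ln (2 : R) by rewrite ln_gt0 // ltr1n.
(* The ratio of the law making [f] and [g] conditionally independent given [h] to the true joint
   law. *)
pose r (x : A * B * C) := marg P G (x.1.1, x.2) * marg P K (x.1.2, x.2) /
   (marg P F x * marg P h x.2).
apply: (@le_trans _ _ (\sum_t P t * ((r (F t) - 1) / ln 2))).
  apply: ler_sum => t _; have [->|Pt] := eqVneq (P t) 0; first by rewrite !mul0r addr0.
  rewrite -mulrDr ler_wpM2l ?is_pmf_ge0//.
  have HF := marg_gt0 F Pt; have HG := marg_gt0 G Pt; have HK := marg_gt0 K Pt.
  have Hh := marg_gt0 h Pt.
  rewrite /log2 -!mulrBl -mulrDl ler_pM2r ?invr_gt0//.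
  have -> : ln (marg P G (G t)) - ln (marg P F (F t)) +
     (ln (marg P K (K t)) - ln (marg P h (h t))) = ln (r (F t)).
    rewrite /r/= ln_div ?posrE ?mulr_gt0// !lnM ?posrE//.
    by rewrite /G /K /=; lra.
  have r0 : 0 < r (F t) by rewrite /r divr_gt0 ?mulr_gt0.
  have := @le_ln1Dx R (r (F t) - 1).
  rewrite (_ : 1 + (r (F t) - 1) = r (F t)); last by lra.
  by apply; lra.
under eq_bigr do rewrite mulrA mulrBr mulr1.
rewrite -mulr_suml sumrB pmfP.2 pmulr_lle0 ?invr_gt0// subr_le0.
rewrite sum_marg.
(* Multiplying by the true law cancels the denominator of [r]. Triples of zero mass contribute zero
   on the left only, hence an inequality. *)
apply: (@le_trans _ _ (\sum_(c : C) \sum_(a : A) \sum_(b : B)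
    marg P G (a, c) * marg P K (b, c) / marg P h c)).
  rewrite -(pair_big xpredT xpredT (fun ab c => marg P F (ab, c) * r (ab, c))) /=.
  rewrite exchange_big /=; apply: ler_sum => c _.
  rewrite -(pair_big xpredT xpredT (fun a b => marg P F (a, b, c) * r (a, b, c))) /=.
  apply: ler_sum => a _; apply: ler_sum => b _; rewrite /r /=.
  have [->|nz] := eqVneq (marg P F (a, b, c)) 0.
    by rewrite mul0r divr_ge0 ?mulr_ge0 ?marg_ge0.
  rewrite invfM (_ : _ * _ = marg P F (a, b, c) / marg P F (a, b, c) *
    (marg P G (a, c) * marg P K (b, c) / marg P h c)); last by ring.
  by rewrite divff// mul1r.
rewrite -pmfP.2 -[leRHS](eq_bigr _ (fun t _ => mulr1 (P t))) (sum_marg h (fun _ => 1)).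
apply: ler_sum => c _; rewrite mulr1.
under eq_bigr do rewrite -mulr_suml -mulr_sumr sum_marg_pair.
rewrite -!mulr_suml sum_marg_pair.
by have [->|nz] := eqVneq (marg P h c) 0; rewrite ?mul0r// mulfK.
Qed.

End Prob.

(** * The outer regions and the cut-set region *)

Section Rout_cutset.
Variables (R : realType) (X Y U V W : finType).
Implicit Types (Q : {ffun X * Y * U * V -> R}).
Notation joint := (W * X * Y * U * V)%type.

Definition dropW (t : joint) : X * Y * U * V := (pX t, pY t, pU t, pV t).

Lemma sum_joint (F : joint -> R) :
  \sum_t F t = \sum_q \sum_w F (w, q.1.1.1, q.1.1.2, q.1.2, q.2).
Proof.
rewrite exchange_big pair_big /=.
rewrite (reindex (fun p : W * (X * Y * U * V) =>
  (p.1, p.2.1.1.1, p.2.1.1.2, p.2.1.2, p.2.2))) //=.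
exists (fun t : joint => (pW t, dropW t)); first by case=> w [[[x y] u] v].
by case=> [[[[w x] y] u] v].
Qed.

Lemma joint_pmf Q (k : {ffun X * Y -> {ffun W -> R}}) :
  is_pmf Q -> is_channel k -> is_pmf (joint_p Q k).
Proof.
move=> [Q0 Q1] kc; split=> [t|]; first by rewrite ffunE mulr_ge0//; apply: (kc _).1.
rewrite sum_joint -Q1; apply: eq_bigr => -[[[x y] u] v] _ /=.
under eq_bigr do rewrite ffunE /=.
by rewrite -mulr_suml (kc _).2 mul1r.
Qed.

(** The rows of the channel sum to one, so summing out [w] restores the source law. *)
Lemma entropy_dropW Q (k : {ffun X * Y -> {ffun W -> R}}) (A : finType)
    (h : X * Y * U * V -> A) : is_channel k ->
  entropy (joint_p Q k) (fun t => h (dropW t)) = entropy Q h.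
Proof.
move=> kc; rewrite /entropy; congr (- _); apply: eq_bigr => a _.
suff -> : marg (joint_p Q k) (fun t => h (dropW t)) a = marg Q h a by [].
rewrite /marg [LHS]big_mkcond [RHS]big_mkcond sum_joint.
apply: eq_bigr => -[[[x y] u] v] _ /=; rewrite /dropW /pX /pY /pU /pV /=.
case: ifP => _; last by rewrite big1.
under eq_bigr do rewrite ffunE /=.
by rewrite -mulr_suml (kc _).2 mul1r.
Qed.

End Rout_cutset.

Section Cutset.
Variable R : realType.

(** With [a] and [b] set to [H(X|U)] and [H(Y|V)], the total rate reaching each decoder must cover
    what its side information leaves unknown. *)
Definition cutset (a b : R) : set (R * R * R) :=
  [set r | [/\ 0 <= r.1.1, 0 <= r.1.2, 0 <= r.2,
               a <= r.1.1 + r.1.2 & b <= r.1.1 + r.2]]%classic.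

Lemma closed_cutset a b : closed (cutset a b).
Proof.
have c1 : continuous (fun r : R * R * R => r.1.1).
  by move=> r; apply: (@continuous_comp _ _ _ fst fst); exact: cvg_fst.
have c2 : continuous (fun r : R * R * R => r.1.2).
  by move=> r; apply: (@continuous_comp _ _ _ fst snd); [exact: cvg_fst|exact: cvg_snd].
have c3 : continuous (fun r : R * R * R => r.2).
  by move=> r; exact: cvg_snd.
have H (f : R * R * R -> R) (c : R) : continuous f -> closed [set r | c <= f r]%classic.
  by move=> cf; apply: (@closed_comp _ _ f [set x | c <= x]%classic)
    (@closed_ge _ c) => x _; exact: cf.
rewrite (_ : cutset a b = [set r | 0 <= r.1.1] `&` [set r | 0 <= r.1.2] `&`
   [set r | 0 <= r.2] `&` [set r | a <= r.1.1 + r.1.2] `&` [set r | b <= r.1.1 +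
     r.2])%classic.
  do !apply: closedI; apply: H => //.
    by move=> r; apply: cvgD; [exact: c1|exact: c2].
  by move=> r; apply: cvgD; [exact: c1|exact: c3].
by apply/seteqP; split=> r /=; [case=> *; do !split|case=> -[[[]]] *; split].
Qed.

Variables (X Y U V : finType) (Q : {ffun X * Y * U * V -> R}).
Hypothesis pmfQ : is_pmf Q.
Notation HX_U := (cond_entropy Q (fun t => t.1.1.1) (fun t => t.1.2)).
Notation HY_V := (cond_entropy Q (fun t => t.1.1.2) (fun t => t.2)).

Lemma Rout_sub_cutset (W : finType) (k : {ffun X * Y -> {ffun W -> R}}) :
  is_channel k -> (Rout (joint_p Q k) `<=` cutset HX_U HY_V)%classic.
Proof.
move=> kc; have pm := joint_pmf pmfQ kc.
move=> r [r0 r1 [r2 _]] hx hy; split=> //; [apply: le_trans hx|apply: le_trans hy].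
  (* By the chain rule, [I(X,Y;W|U) + H(X|W,U) - H(X|U) = I(Y;W|X,U)]. The remaining rewrites only
     bring the tuples into a common order. *)
  have S := entropy_submod pm (@pY _ _ _ _ _) (@pW _ _ _ _ _) (fun t => (pX t, pU t)).
  apply: (@le_trans _ _ (cond_mutinf (joint_p Q k) (@pXY _ _ _ _ _) (@pW _ _ _ _ _)
    (@pU _ _ _ _ _)
     + cond_entropy (joint_p Q k) (@pX _ _ _ _ _) (@pWU _ _ _ _ _))); last first.
    by rewrite lerD2r /Jp le_max lexx.
  move: S; rewrite /cond_mutinf /cond_entropy.
  rewrite -(entropy_dropW Q (fun t => (t.1.1.1, t.1.2)) kc)
    -(entropy_dropW Q (fun t => t.1.2) kc) /dropW /=.
  rewrite (@entropy_ker _ _ _ _ _ (fun t => (pY t, pW t, (pX t, pU t)))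
    (fun t => (pXY t, (pW t, pU t)))); last first.
    by move=> s t _ _; rewrite !xpair_eqE; do !case: (_ == _).
  rewrite (@entropy_ker _ _ _ _ _ (fun t => (pY t, (pX t, pU t)))
    (fun t => (pXY t, pU t))); last first.
    by move=> s t _ _; rewrite !xpair_eqE; do !case: (_ == _).
  rewrite (@entropy_ker _ _ _ _ _ (fun t => (pW t, (pX t, pU t)))
    (fun t => (pX t, pWU t))); last first.
    by move=> s t _ _; rewrite !xpair_eqE; do !case: (_ == _).
  by rewrite /pWU; lra.
(* The same computation with [X], [Y] exchanged and [V] for [U]; the excess is now [I(X;W|Y,V)]. *)
have S := entropy_submod pm (@pX _ _ _ _ _) (@pW _ _ _ _ _) (fun t => (pY t, pV t)).
apply: (@le_trans _ _ (cond_mutinf (joint_p Q k) (@pXY _ _ _ _ _) (@pW _ _ _ _ _)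
  (@pV _ _ _ _ _)
   + cond_entropy (joint_p Q k) (@pY _ _ _ _ _) (@pWV _ _ _ _ _))); last first.
  by rewrite lerD2r /Jp le_max lexx orbT.
move: S; rewrite /cond_mutinf /cond_entropy.
rewrite -(entropy_dropW Q (fun t => (t.1.1.2, t.2)) kc) -(entropy_dropW Q (fun t =>
  t.2) kc) /dropW /=.
rewrite (@entropy_ker _ _ _ _ _ (fun t => (pX t, pW t, (pY t, pV t)))
  (fun t => (pXY t, (pW t, pV t)))); last first.
  by move=> s t _ _; rewrite !xpair_eqE; do !case: (_ == _).
rewrite (@entropy_ker _ _ _ _ _ (fun t => (pX t, (pY t, pV t)))
  (fun t => (pXY t, pV t))); last first.
  by move=> s t _ _; rewrite !xpair_eqE; do !case: (_ == _).
rewrite (@entropy_ker _ _ _ _ _ (fun t => (pW t, (pY t, pV t)))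
  (fun t => (pY t, pWV t))); last first.
  by move=> s t _ _; rewrite !xpair_eqE; do !case: (_ == _).
by rewrite /pWV; lra.
Qed.

Lemma cutset_sub_Rout (W : finType) (w0 : W) :
  exists2 k : {ffun X * Y -> {ffun W -> R}},
    is_channel k & (cutset HX_U HY_V `<=` Rout (joint_p Q k))%classic.
Proof.
pose k : {ffun X * Y -> {ffun W -> R}} := [ffun _ => [ffun w => (w == w0)%:R]].
have kc : is_channel k.
  move=> xy; split=> [w|]; first by rewrite !ffunE ler0n.
  by rewrite (bigD1 w0) //= big1 => [|w /negPf nw]; rewrite !ffunE ?eqxx ?addr0// nw.
exists k => // r [r0 r1 r2 hx hy].
(* [W] is constant on the support, so adjoining it to a tuple leaves the induced partition unchanged
   there. *)
have pw t : joint_p Q k t != 0 -> pW t = w0.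
  by rewrite !ffunE /pW; case: (eqVneq t.1.1.1.1 w0) => // _; rewrite mul0r eqxx.
have mi (A C : finType) (f : W * X * Y * U * V -> A) (c : W * X * Y * U * V -> C) :
    cond_mutinf (joint_p Q k) f (@pW _ _ _ _ _) c = 0.
  rewrite /cond_mutinf /cond_entropy.
  rewrite (@entropy_ker _ _ _ _ _ (fun t => (f t, (pW t, c t)))
    (fun t => (f t, c t))); last first.
    by move=> s t /pw ws /pw wt; rewrite !xpair_eqE ws wt eqxx.
  rewrite (@entropy_ker _ _ _ _ _ (fun t => (pW t, c t)) c) ?subrr//.
  by move=> s t /pw ws /pw wt; rewrite !xpair_eqE ws wt eqxx.
have ce (A B : finType) (f : W * X * Y * U * V -> A) (c : W * X * Y * U * V -> B) :
   cond_entropy (joint_p Q k) f (fun t => (pW t, c t)) = cond_entropy (joint_p Q k) f c.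
  apply/esym/eqP; rewrite -subr_eq0; apply/eqP; exact: mi.
have J0 : Jp (joint_p Q k) = 0 by rewrite /Jp !mi maxxx.
rewrite /Rout /= J0 !add0r /pWU /pWV !ce; split=> //.
  apply: le_trans hx; rewrite /cond_entropy.
  by rewrite -(entropy_dropW Q (fun t => (t.1.1.1, t.1.2)) kc)
    -(entropy_dropW Q (fun t => t.1.2) kc).
apply: le_trans hy; rewrite /cond_entropy.
by rewrite -(entropy_dropW Q (fun t => (t.1.1.2, t.2)) kc)
  -(entropy_dropW Q (fun t => t.2) kc).
Qed.

Lemma Rout_union_cutset : Rout_union Q = cutset HX_U HY_V.
Proof.
apply/seteqP; split=> [r [k [kc]]|r cr]; first exact: Rout_sub_cutset.
(* The [+ 3] in the cardinality supplies an element whatever the sizes of the alphabets. *)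
have w0 : Wset X Y by rewrite /Wset addn3; exact: ord0.
by have [k kc /(_ _ cr) ?] := cutset_sub_Rout w0; exists k.
Qed.

End Cutset.

(** * Asymptotic equipartition *)

Section Log2.
Variable R : realType.
Implicit Types x y : R.

Lemma ln2_gt0 : 0 < ln (2 : R). Proof. by rewrite ln_gt0 // ltr1n. Qed.

Lemma powR2_gt0 x : 0 < 2 `^ x. Proof. by rewrite powR_gt0. Qed.

Lemma powR2D x y : (2 : R) `^ (x + y) = 2 `^ x * 2 `^ y.
Proof. by rewrite powRD// pnatr_eq0 implybT. Qed.

Lemma log2_powR x : log2 (2 `^ x) = x.
Proof. by rewrite /log2 ln_powR mulfK// gt_eqF ?ln2_gt0. Qed.

Lemma ler_log2 x y : 0 < x -> 0 < y -> (log2 x <= log2 y) = (x <= y).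
Proof. by move=> x0 y0; rewrite /log2 ler_pM2r ?invr_gt0 ?ln2_gt0// ler_ln. Qed.

Lemma powR2_le x y : 0 < x -> (2 `^ y <= x) = (y <= log2 x).
Proof. by move=> x0; rewrite -(ler_log2 (powR2_gt0 y) x0) log2_powR. Qed.

Lemma le_powR2 x y : 0 < x -> (x <= 2 `^ y) = (log2 x <= y).
Proof. by move=> x0; rewrite -(ler_log2 x0 (powR2_gt0 y)) log2_powR. Qed.

Lemma log2M x y : 0 < x -> 0 < y -> log2 (x * y) = log2 x + log2 y.
Proof. by move=> x0 y0; rewrite /log2 lnM// mulrDl. Qed.

Lemma log2_prod (I : finType) (F : I -> R) : (forall i, 0 < F i) ->
  log2 (\prod_i F i) = \sum_i log2 (F i).
Proof.
move=> F0; have : 0 < \prod_i F i /\ log2 (\prod_i F i) = \sum_i log2 (F i).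
  elim/big_rec2: _ => [|i s p _ [p0 IH]]; first by rewrite ltr01 /log2 ln1 mul0r.
  by rewrite mulr_gt0// log2M// IH.
by case.
Qed.

End Log2.

(** For [f] a coordinate projection this is convertible to [seqX], [seqY], [seqU] or [seqV], and the
    proofs below pass silently between the two. *)
Definition smap (T A : finType) (f : T -> A) (n : nat) (s : {ffun 'I_n -> T}) :
  {ffun 'I_n -> A} := [ffun i => f (s i)].

Section Iid.
Variables (R : realType) (T : finType) (Q : {ffun T -> R}).

Definition iid (n : nat) : {ffun {ffun 'I_n -> T} -> R} :=
  [ffun s : {ffun 'I_n -> T} => \prod_i Q (s i)].

Lemma iid_probE n (E : pred {ffun 'I_n -> T}) : iid_prob Q E = prob (iid n) E.
Proof. by apply: eq_bigr => s _; rewrite ffunE. Qed.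

(** Independence of the coordinates, as distributivity of product over sum. Suitable choices of [G]
    give marginals, total mass and second moments. *)
Lemma iid_expect n (G : 'I_n -> T -> R) :
  \sum_(s : {ffun 'I_n -> T}) iid n s * \prod_i G i (s i) = \prod_i \sum_t Q t * G i t.
Proof.
by rewrite bigA_distr_bigA; apply: eq_bigr => s _; rewrite ffunE -big_split.
Qed.

Lemma marg_iid (A : finType) (f : T -> A) n (a : {ffun 'I_n -> A}) :
  marg (iid n) (@smap _ _ f n) a = \prod_i marg Q f (a i).
Proof.
rewrite /marg (eq_bigr (fun i => \sum_t Q t * (f t == a i)%:R)); last first.
  by move=> i _; rewrite big_mkcond; apply: eq_bigr => t _; case: eqP;
    rewrite ?mulr1 ?mulr0.
rewrite -iid_expect [LHS]big_mkcond; apply: eq_bigr => s _.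
case: eqP => [<-|ne]; first by rewrite big1 ?mulr1// => i _; rewrite ffunE eqxx.
suff [i ni] : exists i, f (s i) != a i by rewrite (bigD1 i) //= (negPf ni) mul0r mulr0.
apply/existsP; rewrite -negb_forall; apply/negP => /forallP H; apply: ne.
by apply/ffunP => i; rewrite ffunE; exact/eqP.
Qed.

Lemma cprob_iid (A B : finType) (f : T -> A) (g : T -> B) n a b :
  cprob (iid n) (@smap _ _ f n) (@smap _ _ g n) a b = \prod_i cprob Q f g (a i) (b i).
Proof.
rewrite /cprob big_split /= prodfV marg_iid; congr (_ / _).
(* A pair of sequences is identified with a sequence of pairs, to which [marg_iid] applies. *)
transitivity (marg (iid n) (@smap _ _ (fun t => (f t, g t)) n) [ffun i => (a i, b i)]).
  apply: eq_bigl => s; rewrite xpair_eqE.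
  apply/andP/eqP => [[/eqP <- /eqP <-]|/ffunP H].
    by apply/ffunP => i; rewrite !ffunE.
  by split; apply/eqP/ffunP => i; have := H i; rewrite !ffunE => -[].
by rewrite marg_iid; apply: eq_bigr => i _; rewrite ffunE.
Qed.

Hypothesis pmfQ : is_pmf Q.

Lemma iid_pmf n : is_pmf (iid n).
Proof.
split=> [s|]; first by rewrite ffunE prodr_ge0// => i _; exact: pmfQ.1.
have := iid_expect (fun (_ : 'I_n) _ => 1).
rewrite (eq_bigr (iid n)) => [->|s _]; last by rewrite big1 ?mulr1//.
rewrite big1// => i _; rewrite -[RHS]pmfQ.2.
by apply: eq_bigr => t _; rewrite mulr1.
Qed.

Lemma iid_supp n s i : iid n s != 0 -> Q (s i) != 0.
Proof. by rewrite ffunE; apply: contra_neq => H; rewrite (bigD1 i) //= H mul0r. Qed.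

(** Chebyshev's inequality: the centred sum has second moment [n * v], since the cross terms vanish
    by independence. *)
Lemma wlln (h : T -> R) (c d : R) : 0 < c -> 0 < d ->
  exists N, forall n, (N <= n)%N ->
  prob (iid n) (fun s => n%:R * c <= `|\sum_i h (s i) - n%:R * \sum_t Q t * h t|) <= d.
Proof.
move=> c0 d0; set mu := \sum_t Q t * h t; pose g t := h t - mu.
have g0 : \sum_t Q t * g t = 0.
  under eq_bigr do rewrite mulrBr.
  by rewrite sumrB -mulr_suml pmfQ.2 mul1r subrr.
pose v := \sum_t Q t * (g t) ^+ 2.
have v0 : 0 <= v by apply: sumr_ge0 => t _; rewrite mulr_ge0 ?sqr_ge0// pmfQ.1.
have Eg n : \sum_(s : {ffun 'I_n -> T}) iid n s * (\sum_i g (s i)) ^+ 2 = n%:R * v.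
  transitivity (\sum_(i < n) \sum_(j < n) \sum_(s : {ffun 'I_n -> T})
    iid n s * (g (s i) * g (s j))).
    under [RHS]eq_bigr do rewrite exchange_big.
    rewrite exchange_big /=; apply: eq_bigr => s _.
    rewrite expr2 mulr_suml mulr_sumr; apply: eq_bigr => i _.
    by rewrite !mulr_sumr; apply: eq_bigr => j _.
  transitivity (\sum_(i < n) v); last by rewrite sumr_const card_ord mulr_natl.
  apply: eq_bigr => i _; rewrite (bigD1 i) //= [X in _ + X]big1 ?addr0; last first.
    move=> j ji.
    (* The cross term is written as a product over all coordinates; the factor at [i] then has
       expectation zero. *)
    pose G (k : 'I_n) t := (if k == i then g t else 1) * (if k == j then g t else 1).
    transitivity (\sum_(s : {ffun 'I_n -> T}) iid n s * \prod_k G k (s k)).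
      apply: eq_bigr => s _; rewrite big_split /=.
      by rewrite -!big_mkcond !big_pred1_eq.
    rewrite iid_expect (bigD1 i) //= /G eqxx eq_sym (negPf ji).
    by under eq_bigr do rewrite mulr1; rewrite g0 mul0r.
  transitivity (\sum_(s : {ffun 'I_n -> T}) iid n s * \prod_(k < n)
    if k == i then g (s k) ^+ 2 else 1).
    by apply: eq_bigr => s _; rewrite -big_mkcond big_pred1_eq expr2.
  rewrite (iid_expect (fun k t => if k == i then g t ^+ 2 else 1)) (bigD1 i)
    //= eqxx [X in _ * X]big1 ?mulr1// => k /negPf ->.
  by rewrite -[RHS]pmfQ.2; apply: eq_bigr => t _; rewrite mulr1.
(* From this [n] on, the Chebyshev bound [v / (n * c ^+ 2)] is at most [d]. *)
exists (Num.truncn (v / (c ^+ 2 * d))).+1 => n nN.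
have n0 : 0 < n%:R :> R by rewrite ltr0n; apply: leq_trans nN.
have cn : v <= n%:R * c ^+ 2 * d.
  rewrite -mulrA -ler_pdivrMr ?mulr_gt0 ?exprn_gt0//.
  apply: (@le_trans _ _ (Num.truncn (v / (c ^+ 2 * d))).+1%:R); last by rewrite ler_nat.
  by apply/ltW/truncnS_gt.
set E := fun s => _.
have : (n%:R * c) ^+ 2 * prob (iid n) E <= n%:R * v.
  rewrite -Eg /prob mulr_sumr [leLHS]big_mkcond /=; apply: ler_sum => s _.
  have s0 : 0 <= iid n s := (iid_pmf n).1 s.
  case: ifP => [Es|_]; last by rewrite mulr_ge0 ?sqr_ge0.
  rewrite mulrC ler_wpM2l//; move: Es; rewrite /E.
  have -> : \sum_i h (s i) - n%:R * mu = \sum_i g (s i).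
    by rewrite sumrB sumr_const card_ord mulr_natl.
  move=> Es; rewrite -(real_normK (num_real (\sum_i g (s i)))).
  have nc0 : 0 <= n%:R * c by rewrite mulr_ge0// ltW.
  by rewrite lerXn2r.
rewrite -ler_pdivlMl ?exprn_gt0 ?mulr_gt0// => /le_trans; apply.
rewrite ler_pdivrMl ?exprn_gt0 ?mulr_gt0//.
have -> : (n%:R * c) ^+ 2 * d = n%:R * (n%:R * c ^+ 2 * d) by ring.
by rewrite ler_pM2l.
Qed.

(** The logarithm turns the product of conditional probabilities into a sum of independent terms,
    whose common mean is [- H]; the weak law then applies. *)
Lemma aep (A B : finType) (f : T -> A) (g : T -> B) (c d : R) : 0 < c -> 0 < d ->
  let H := cond_entropy Q f g in
  exists N, forall n, (N <= n)%N ->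
  prob (iid n) (fun s =>
    let w := cprob (iid n) (@smap _ _ f n) (@smap _ _ g n) (smap f s) (smap g s) in
    ~~ (2 `^ (- (n%:R * (H + c))) <= w <= 2 `^ (- (n%:R * (H - c))))) <= d.
Proof.
move=> c0 d0 H.
have [N HN] := wlln (fun t => - log2 (cprob Q f g (f t) (g t))) c0 d0.
exists N => n /HN; rewrite -cond_entropyE// -/H; apply: le_trans.
apply: prob_le => [|s s0]; first exact: iid_pmf.
rewrite /= cprob_iid; under eq_bigr do rewrite !ffunE.
set w := \prod_(i < n) _.
have w0 i : 0 < cprob Q f g (f (s i)) (g (s i)) by rewrite cprob_gt0// iid_supp.
have pw : 0 < w by rewrite prodr_gt0.
rewrite powR2_le// le_powR2// /w log2_prod// sumrN; apply: contraR.
rewrite -ltNge ltr_norml => /andP[h1 h2].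
by rewrite mulrDr [n%:R * (H - c)]mulrBr; apply/andP; split; lra.
Qed.

End Iid.

(** * Converse *)

Section Converse.
Variable R : realType.

Lemma pmf_inhabited (T : finType) (P : {ffun T -> R}) :
  is_pmf P -> exists t : T, P t != 0.
Proof.
move=> [_ P1]; apply/existsP; apply: contraT; rewrite negb_exists => /forallP H.
move: P1; rewrite big1 => [/esym/eqP|t _]; first by rewrite oner_eq0.
by apply/eqP; have := H t; rewrite negbK.
Qed.

Section OneShot.
Variables (S A B : finType) (P : {ffun S -> R}) (F : S -> A) (G : S -> B).
Hypothesis pmfP : is_pmf P.

Lemma marg_pairE a b :
  marg P (fun s => (F s, G s)) (a, b) = cprob P F G a b * marg P G b.
Proof.
have [b0|nz] := eqVneq (marg P G b) 0; last by rewrite /cprob divfK.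
rewrite b0 mulr0; apply/le_anti; rewrite marg_ge0// andbT -b0.
by apply: prob_le => // s _ /eqP [_ ->].
Qed.

(** A correct decoding of a value of conditional probability at most [th] is charged to its message:
    for a fixed message [k] and side information [b] only [D k b] counts, which costs at most
    [th * marg P G b]. *)
Lemma oneshot_converse (C : finType) (c : S -> C) (D : C -> B -> A) (th : R) : 0 <= th ->
  prob P (fun s => D (c s) (G s) == F s) <=
  prob P (fun s => th < cprob P F G (F s) (G s)) + #|C|%:R * th.
Proof.
move=> th0.
apply: (@le_trans _ _ (prob P (fun s => (th < cprob P F G (F s) (G s)) ||
  ((D (c s) (G s) == F s) && (cprob P F G (F s) (G s) <= th))))).
  by apply: prob_le => // s _ ->; rewrite andTb leNgt orbN.
apply: le_trans (probU pmfP _ _) _; rewrite lerD2l.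
(* Summing over every [k] in place of the transmitted [c s] removes the encoder, leaving a function
   of [(F s, G s)] alone. *)
pose h k (x : A * B) : R := ((D k x.2 == x.1) && (cprob P F G x.1 x.2 <= th))%:R.
apply: (@le_trans _ _ (\sum_k \sum_s P s * h k (F s, G s))).
  rewrite exchange_big /= /prob [leLHS]big_mkcond /=; apply: ler_sum => s _.
  rewrite -mulr_sumr; case: ifP => [E|_]; last first.
    by apply: mulr_ge0; [exact: is_pmf_ge0 pmfP _|apply: sumr_ge0 => k _; exact: ler0n].
  rewrite -[leLHS]mulr1 ler_wpM2l ?(is_pmf_ge0 pmfP)// (bigD1 (c s)) //= /h /= E lerDl.
  by apply: sumr_ge0 => k _; exact: ler0n.
rewrite -sum1_card natr_sum mulr_suml; apply: ler_sum => k _; rewrite mul1r.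
rewrite (sum_marg P (fun s => (F s, G s)) (h k)).
rewrite -(pair_big xpredT xpredT (fun a b => marg P (fun s => (F s, G s)) (a, b)
  * h k (a, b))) /=.
rewrite exchange_big /=.
apply: (@le_trans _ _ (\sum_b th * marg P G b)); last first.
  rewrite -mulr_sumr -[X in _ * X](eq_bigr _ (fun b _ => mulr1 (marg P G b))).
  rewrite -(sum_marg P G (fun _ => 1)) (eq_bigr P) ?pmfP.2 ?mulr1// => s _.
  by rewrite mulr1.
apply: ler_sum => b _; rewrite (bigD1 (D k b)) //= big1 ?addr0 => [|a na]; last first.
  by rewrite /h /= eq_sym (negPf na) mulr0.
rewrite /h /= eqxx marg_pairE /=; case: (leP (cprob P F G (D k b) b) th) => hw;
  last first.
  by rewrite mulr0 mulr_ge0 ?marg_ge0.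
by rewrite mulr1 ler_wpM2r ?marg_ge0.
Qed.

End OneShot.

(** This treats one decoder in isolation. The message alphabet is an arbitrary finite type so that
    the pairs [(M0, M1)] and [(M0, M2)] both fit. *)
Lemma coding_converse (T A B : finType) (Q : {ffun T -> R}) (f : T -> A) (g : T -> B)
    (r : R) : is_pmf Q ->
  (forall eps, 0 < eps -> exists N, forall n, (N <= n)%N ->
     exists (C : finType) (c : {ffun 'I_n -> T} -> C)
       (D : C -> {ffun 'I_n -> B} -> {ffun 'I_n -> A}),
     prob (iid Q n) (fun s => D (c s) (smap g s) != smap f s) <= eps /\
     log2 (#|C|%:R : R) / n%:R <= r + eps) ->
  cond_entropy Q f g <= r.
Proof.
move=> pmfQ ach; set H := cond_entropy Q f g; rewrite leNgt; apply/negP => rH.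
(* With threshold exponent [n * (H - d / 4)] and rate at most [r + d / 4], messages times threshold
   is at most [2 ^ (- n * d / 2)], which is at most [1/4] once [n >= 4 / d]. Error, atypicality and
   this term then total at most [3/4], while they should reach one. *)
pose d := H - r; have d0 : 0 < d by rewrite subr_gt0.
pose eps := Num.min (d / 4) (4^-1).
have eps0 : 0 < eps by rewrite lt_min divr_gt0 //= invr_gt0.
have [N1 HN1] := ach _ eps0.
have d4 : 0 < d / 4 by rewrite divr_gt0.
have q4 : 0 < (4^-1 : R) by rewrite invr_gt0.
have [N2 HN2] := aep pmfQ f g d4 q4.
pose N3 := (Num.truncn (4 / d)).+1.
pose n := maxn N1 (maxn N2 N3).
have [n1 n2 n3] : [/\ (N1 <= n)%N, (N2 <= n)%N & (N3 <= n)%N].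
  by rewrite /n; split; lia.
have {n1 HN1} [C [c [D [pe rate]]]] := HN1 _ n1.
have {n2} aepn := HN2 _ n2.
have nn3 : 4 / d <= n%:R.
  apply: (@le_trans _ _ N3%:R); last by rewrite ler_nat.
  exact/ltW/truncnS_gt.
have n0 : 0 < n%:R :> R by apply: lt_le_trans nn3; rewrite divr_gt0.
have pmfn := iid_pmf pmfQ n.
have C0 : (0 < #|C|)%N by have [s _] := pmf_inhabited pmfn; apply/card_gt0P; exists (c s).
have := oneshot_converse (smap f (n:=n)) (smap g (n:=n)) pmfn c D
  (ltW (powR2_gt0 (- (n%:R * (H - d / 4))))).
have h1 : #|C|%:R * 2 `^ (- (n%:R * (H - d / 4))) <= 4^-1 :> R.
  rewrite [leRHS](_ : _ = 2 `^ (- 2)); last first.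
    by rewrite powRN powR_mulrn; [congr (_^-1); ring|exact: ler0n].
  rewrite le_powR2 ?mulr_gt0 ?powR2_gt0 ?ltr0n// log2M ?powR2_gt0 ?ltr0n// log2_powR.
  have e1 : eps <= d / 4 by rewrite ge_min lexx.
  have e2 : n%:R * eps <= n%:R * (d / 4) by rewrite ler_pM2l.
  move: rate nn3; rewrite (ler_pdivrMr _ _ n0) (ler_pdivrMr _ _ d0).
  have : H = r + d by rewrite /d; lra.
  move: e2; rewrite -/H; clearbody H d eps n; set L := log2 _.
  move=> e2 -> e3 e4; nra.
have h2 : prob (iid Q n) (fun s => 2 `^ (- (n%:R * (H - d / 4))) <
    cprob (iid Q n) (smap f (n:=n)) (smap g (n:=n)) (smap f s) (smap g s)) <= 4^-1.
  apply: le_trans aepn; apply: prob_le => // s _ h.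
  by rewrite /= negb_and -!ltNge h orbT.
have h3 : eps <= 4^-1 by rewrite ge_min lexx orbT.
have := probC pmfn (fun s => D (c s) (smap g s) == smap f s).
move: pe h1 h2 h3.
set a := prob _ _; set b := prob _ _; set e := prob _ _; set k := _ * _; lra.
Qed.

End Converse.

Section AchievableConverse.
Variables (R : realType) (X Y U V : finType) (Q : {ffun X * Y * U * V -> R}).
Hypothesis pmfQ : is_pmf Q.

Lemma achievable_sub_cutset :
  (achievable_region Q `<=` cutset
    (cond_entropy Q (fun t => t.1.1.1) (fun t => t.1.2))
    (cond_entropy Q (fun t => t.1.1.2) (fun t => t.2)))%classic.
Proof.
move=> r ach.
(* The encoder output on any sequence inhabits the message sets, so their sizes are positive; this
   yields the sign constraints on the rates. *)
have log2_ge0 (m n : nat) : 'I_m -> 0 <= log2 (m%:R : R) / n%:R.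
  move=> i; have m0 : (0 < m)%N := leq_ltn_trans (leq0n i) (ltn_ord i).
  by rewrite !divr_ge0 ?ler0n ?ln_ge0 ?ler1n.
have ach' eps : 0 < eps -> exists N, forall n, (N <= n)%N -> 
   [/\ 0 <= r.1.1 + eps, 0 <= r.1.2 + eps & 0 <= r.2 + eps].
  move=> /ach [N HN]; exists N => n /HN [m0 [m1 [m2 [e [dx [dy [_ r0 r1 r2]]]]]]].
  have [s _] := pmf_inhabited (iid_pmf pmfQ n).
  case: (e (seqX s) (seqY s)) => -[i0 i1] i2.
  by split; [apply: le_trans r0|apply: le_trans r1|apply: le_trans r2]; exact: log2_ge0.
split.
- by apply/ler_addgt0Pr => eps /ach' [N /(_ N (leqnn _))] [].
- by apply/ler_addgt0Pr => eps /ach' [N /(_ N (leqnn _))] [].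
- by apply/ler_addgt0Pr => eps /ach' [N /(_ N (leqnn _))] [].
- apply: coding_converse => // eps eps0.
  (* The rates of two messages add up, so each is allowed half of the slack. *)
  have e2 : 0 < eps / 2 by rewrite divr_gt0.
  have [N HN] := ach _ e2; exists N => n /HN [m0 [m1 [m2 [e [dx [dy [pe r0 r1 r2]]]]]]].
  exists ('I_m0 * 'I_m1)%type, (fun s => (e (seqX s) (seqY s)).1),
    (fun m => dx m.1 m.2); split.
    apply: (@le_trans _ _ (eps / 2)); last by lra.
    by apply: le_trans pe; rewrite le_max -iid_probE lexx.
  have [s _] := pmf_inhabited (iid_pmf pmfQ n).
  have [i0 i1] := (e (seqX s) (seqY s)).1.
  rewrite card_prod !card_ord natrM log2M ?ltr0n ?(leq_ltn_trans _ (ltn_ord i0))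
    ?(leq_ltn_trans _ (ltn_ord i1))//.
  by rewrite mulrDl; lra.
- apply: coding_converse => // eps eps0.
  have e2 : 0 < eps / 2 by rewrite divr_gt0.
  have [N HN] := ach _ e2; exists N => n /HN [m0 [m1 [m2 [e [dx [dy [pe r0 r1 r2]]]]]]].
  exists ('I_m0 * 'I_m2)%type, (fun s => ((e (seqX s) (seqY s)).1.1, (e (seqX s)
    (seqY s)).2)), (fun m => dy m.1 m.2); split.
    apply: (@le_trans _ _ (eps / 2)); last by lra.
    by apply: le_trans pe; rewrite le_max -!iid_probE lexx orbT.
  have [s _] := pmf_inhabited (iid_pmf pmfQ n).
  have i0 := (e (seqX s) (seqY s)).1.1; have i1 := (e (seqX s) (seqY s)).2.
  rewrite card_prod !card_ord natrM log2M ?ltr0n ?(leq_ltn_trans _ (ltn_ord i0))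
    ?(leq_ltn_trans _ (ltn_ord i1))//.
  by rewrite mulrDl; lra.
Qed.

End AchievableConverse.

(** * Random binning *)

Section Average.
Variable R : realType.

(** Expectation under the uniform law; [T] will be a space of bin assignments, so this averages over
    random codes. *)
Definition avg (T : finType) (F : T -> R) : R := (\sum_t F t) / #|T|%:R.

Section AvgTheory.
Variable T : finType.
Implicit Types F G : T -> R.

Lemma eq_avg F G : F =1 G -> avg F = avg G.
Proof. by move=> FG; congr (_ / _); apply: eq_bigr. Qed.

Lemma ler_avg F G : (forall t, F t <= G t) -> avg F <= avg G.
Proof.
by move=> FG; rewrite ler_wpM2r ?invr_ge0// ler_sum.
Qed.

Lemma avgD F G : avg (fun t => F t + G t) = avg F + avg G.
Proof. by rewrite /avg big_split mulrDl. Qed.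

Lemma avgZ (c : R) F : avg (fun t => c * F t) = c * avg F.
Proof. by rewrite /avg -mulr_sumr mulrA. Qed.

Lemma avg_sum (I : finType) (p : pred I) (F : I -> T -> R) :
  avg (fun t => \sum_(i | p i) F i t) = \sum_(i | p i) avg (F i).
Proof. by rewrite /avg exchange_big /= mulr_suml. Qed.

Lemma avg_cst (c : R) : (0 < #|T|)%N -> avg (fun _ : T => c) = c.
Proof.
by move=> T0; rewrite /avg sumr_const -[c *+ _]mulr_natr mulfK// pnatr_eq0 -lt0n.
Qed.

Lemma avg_exists F (c : R) : (0 < #|T|)%N -> avg F <= c -> exists t, F t <= c.
Proof.
move=> T0; apply: contraPP => /forallNP H; apply/negP; rewrite -ltNge -(avg_cst c T0).
rewrite /avg ltr_pM2r ?invr_gt0 ?ltr0n//.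
have /card_gt0P [t _] := T0.
by apply: ltr_sum => [|i _]; [apply/hasP; exists t; rewrite ?mem_index_enum| rewrite
  ltNge; apply/negP/H].
Qed.

End AvgTheory.

Lemma avgM (S T : finType) (F : S -> R) (G : T -> R) :
  avg (fun p : S * T => F p.1 * G p.2) = avg F * avg G.
Proof.
rewrite /avg -(pair_big xpredT xpredT (fun s t => F s * G t)) /=.
under eq_bigr do rewrite -mulr_sumr.
by rewrite -mulr_suml card_prod natrM invfM; ring.
Qed.

(** The collision is split by the common bin [b]: the two values fall independently into [b], and
    [m] bins of probability [m ^ (-2)] each sum to [1 / m]. *)
Lemma avg_collision (A : finType) (m : nat) (a a' : A) : (0 < m)%N -> a' != a ->
  avg (fun f : {ffun A -> 'I_m} => (f a' == f a)%:R) = m%:R^-1.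
Proof.
move=> m0 na; have mr : (m%:R : R) != 0 by rewrite pnatr_eq0 -lt0n.
pose G (b : 'I_m) i (j : 'I_m) : R :=
  (if i == a then (j == b)%:R else 1) * (if i == a' then (j == b)%:R else 1).
rewrite (@eq_avg _ _ (fun f : {ffun A -> 'I_m} => \sum_b \prod_i G b i (f i)));
  last first.
  move=> f; under eq_bigr do rewrite big_split /= -!big_mkcond !big_pred1_eq.
  rewrite (bigD1 (f a)) //= eqxx mul1r big1 ?addr0// => b.
  by rewrite eq_sym => /negPf ->; rewrite mul0r.
rewrite avg_sum (eq_bigr (fun _ => m%:R^-1 ^+ 2)); last first.
  move=> b _; rewrite /avg card_ffun card_ord natrX -exprVn -(prodr_const A).
  rewrite -bigA_distr_bigA -big_split /= (bigD1 a) //= (bigD1 a')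
    //= [X in _ * (_ * X)]big1; last first.
    move=> i /andP [/negPf ia /negPf ia']; rewrite /G ia ia'.
    by under eq_bigr do rewrite mulr1; rewrite sumr_const card_ord divff.
  have E c : \sum_j (j == b)%:R / c = c^-1 :> R.
    by rewrite -mulr_suml (bigD1 b) //= eqxx big1 ?addr0 ?mul1r// => j /negPf ->.
  rewrite /G !eqxx (negPf na) eq_sym (negPf na) mulr1 expr2.
  congr (_ * _); under eq_bigr do rewrite ?mulr1 ?mul1r; rewrite mulr_suml; exact: E.
by rewrite sumr_const card_ord -[_ ^+ 2 *+ _]mulr_natr expr2 -mulrA mulVf// mulr1.
Qed.

End Average.

Section OneShot.
Variables (R : realType) (S A B C D : finType) (P : {ffun S -> R}).
Variables (Fx : S -> A) (Fy : S -> C) (Gu : S -> B) (Gv : S -> D) (phi : C -> A).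
Variables (T1 : B -> pred A) (T2 : D -> pred C).
Variables (K1 K2 K3 : R) (ms m1 mt m2 : nat).
Hypothesis pmfP : is_pmf P.
Hypothesis suppP : forall s, P s != 0 -> phi (Fy s) = Fx s.
Hypothesis card1 : forall u, #|T1 u|%:R <= K1.
Hypothesis card2 : forall v, #|T2 v|%:R <= K2.
Hypothesis card3 : forall v a, #|[pred c | T2 v c && (phi c == a)]|%:R <= K3.
Hypotheses (ms0 : (0 < ms)%N) (m10 : (0 < m1)%N) (mt0 : (0 < mt)%N) (m20 : (0 < m2)%N).

(** The decoder picks a candidate of the list [T] in the same bins as the truth [e]. If [e] is in
    [T] the search succeeds, so the default [e0] is returned only in the case charged to the first
    term; any other wrong answer is a collision. *)
Lemma pick_err (E : finType) (e0 : E) (T : pred E) (h : E -> E -> bool) (e : E) :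
  h e e -> (odflt e0 [pick e' | T e' && h e' e] != e)%:R <=
    (~~ T e)%:R + \sum_(e' | T e' && (e' != e)) (h e' e)%:R :> R.
Proof.
move=> hee; have s0 : 0 <= \sum_(e' | T e' && (e' != e)) (h e' e)%:R :> R.
  by apply: sumr_ge0 => e' _; exact: ler0n.
case Te : (T e) => /=; last by apply: ler_wpDr => //; rewrite ler_nat leq_b1.
rewrite add0r; case: pickP => [e' /andP [Te' he'] /=|/(_ e)]; last by rewrite Te hee.
have [//|ne] := eqVneq e' e.
rewrite (bigD1 e') /= ?Te'// he' lerDl.
by apply: sumr_ge0 => i _; exact: ler0n.
Qed.

(** Here [T1] and [T2] are the candidate lists of the decoders, and [phi] recovers the first source
    from the second. Bounding the sum of both errors lets a single draw of the binnings serve both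
    decoders. *)
Lemma oneshot_binning :
  exists (f0 : A -> 'I_ms) (f1 : A -> 'I_m1) (g0 : C -> 'I_mt) (g2 : C -> 'I_m2)
    (dx : 'I_ms -> 'I_m1 -> B -> A) (dy : 'I_ms -> 'I_mt -> 'I_m2 -> D -> C),
  prob P (fun s => dx (f0 (Fx s)) (f1 (Fx s)) (Gu s) != Fx s) +
  prob P (fun s => dy (f0 (Fx s)) (g0 (Fy s)) (g2 (Fy s)) (Gv s) != Fy s) <=
  prob P (fun s => ~~ T1 (Gu s) (Fx s)) + K1 / (ms%:R * m1%:R) +
  (prob P (fun s => ~~ T2 (Gv s) (Fy s)) +
    (K2 / (ms%:R * mt%:R * m2%:R) + K3 / (mt%:R * m2%:R))).
Proof.
have [s0 _] := pmf_inhabited pmfP.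
pose Om := ({ffun A -> 'I_ms} * {ffun A -> 'I_m1} * {ffun C -> 'I_mt} * {ffun C ->
  'I_m2})%type.
have nz (I : finType) m : (0 < m)%N -> (0 < #|{ffun I -> 'I_m}|)%N.
  by move=> m0; rewrite card_ffun expn_gt0 card_ord m0.
have Om0 : (0 < #|{: Om}|)%N by rewrite !card_prod !muln_gt0 !nz.
pose hx (w : Om) a' a := (w.1.1.1 a' == w.1.1.1 a) && (w.1.1.2 a' == w.1.1.2 a).
pose hy (w : Om) c' c := [&& w.1.1.1 (phi c') == w.1.1.1 (phi c), w.1.2 c' == w.1.2 c
   & w.2 c' == w.2 c].
pose dx (w : Om) i j u :=
  odflt (Fx s0) [pick a | T1 u a && ((w.1.1.1 a == i) && (w.1.1.2 a == j))].
pose dy (w : Om) i j k v :=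
  odflt (Fy s0) [pick c | T2 v c && [&& w.1.1.1 (phi c) == i, w.1.2 c == j & w.2 c == k]].
pose ex (w : Om) s := dx w (w.1.1.1 (Fx s)) (w.1.1.2 (Fx s)) (Gu s) != Fx s.
pose ey (w : Om) s := dy w (w.1.1.1 (Fx s)) (w.1.2 (Fy s)) (w.2 (Fy s)) (Gv s) != Fy s.
(* Exchanging the averages over codes and over the source reduces the bound to one fixed source
   outcome in the support. *)
have avgP (e : Om -> S -> bool) (E : pred S) (K : R) :
    (forall s, P s != 0 -> avg (fun w => (e w s)%:R) <= (E s)%:R + K) ->
    avg (fun w => prob P (e w)) <= prob P E + K.
  move=> H; rewrite (@eq_avg _ _ _ (fun w => \sum_s P s * (e w s)%:R)); last first.
    move=> w; rewrite /prob big_mkcond; apply: eq_bigr => s _.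
    by case: (e w s); rewrite ?mulr1 ?mulr0.
  rewrite avg_sum; apply: (@le_trans _ _ (\sum_s P s * ((E s)%:R + K))).
    apply: ler_sum => s _; rewrite avgZ.
    have [->|Ps] := eqVneq (P s) 0; first by rewrite !mul0r.
    by rewrite ler_wpM2l ?(is_pmf_ge0 pmfP)// H.
  under eq_bigr do rewrite mulrDr.
  rewrite big_split /= -mulr_suml pmfP.2 mul1r lerD2r /prob [leRHS]big_mkcond /=.
  by apply: ler_sum => s _; case: (E s); rewrite ?mulr1 ?mulr0.
have avg4 F1 F2 F3 F4 : avg (fun w : Om => F1 w.1.1.1 * F2 w.1.1.2 * F3 w.1.2 * F4 w.2) =
     avg F1 * avg F2 * avg F3 * avg F4 :> R.
  by rewrite (avgM (fun w : {ffun A -> 'I_ms} * {ffun A -> 'I_m1} * {ffun C -> 'I_mt} =>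
      F1 w.1.1 * F2 w.1.2 * F3 w.2) F4)
    (avgM (fun w : {ffun A -> 'I_ms} * {ffun A -> 'I_m1} => F1 w.1 * F2 w.2) F3) avgM.
have Hx a a' : a' != a -> avg (fun w => (hx w a' a)%:R) = (ms%:R * m1%:R)^-1 :> R.
  move=> na; pose F m (f : {ffun A -> 'I_m}) : R := (f a' == f a)%:R.
  pose G m (f : {ffun C -> 'I_m}) : R := 1.
  rewrite (@eq_avg _ _ _ (fun w : Om => F _ w.1.1.1 * F _ w.1.1.2 * G _ w.1.2 * G _ w.2)).
    by rewrite avg4 /F /G !avg_cst ?nz// !mulr1 !avg_collision// invfM.
  by move=> w; rewrite /= !mulr1 -natrM mulnb.
(* When [phi c'] equals [phi c] their bins under the first map agree automatically, and the factor
   [ms] is lost. *)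
have Hy c c' : c' != c -> avg (fun w => (hy w c' c)%:R) =
    (if phi c' == phi c then (mt%:R * m2%:R)^-1 else (ms%:R * mt%:R * m2%:R)^-1) :> R.
  move=> na; pose F m (f : {ffun C -> 'I_m}) : R := (f c' == f c)%:R.
  pose F' m (f : {ffun A -> 'I_m}) : R := (f (phi c') == f (phi c))%:R.
  pose G m (f : {ffun A -> 'I_m}) : R := 1.
  rewrite (@eq_avg _ _ _ (fun w : Om => F' _ w.1.1.1 * G _ w.1.1.2 * F _ w.1.2 * F _
    w.2)); last first.
    by move=> w; rewrite /= mulr1 -!natrM !mulnb -andbA.
  rewrite avg4 /F /G avg_cst ?nz// mulr1 !(avg_collision _ _ na)// /F'.
  have [->|np] := eqVneq (phi c') (phi c); last by rewrite avg_collision// !invfM.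
  by rewrite (@eq_avg _ _ _ (fun=> 1)) ?avg_cst ?nz// ?mul1r ?invfM// => f; rewrite eqxx.
have Ax : avg (fun w => prob P (ex w)) <=
    prob P (fun s => ~~ T1 (Gu s) (Fx s)) + K1 / (ms%:R * m1%:R).
  apply: avgP => s _; apply: (@le_trans _ _ (avg (fun w => (~~ T1 (Gu s) (Fx s))%:R +
      \sum_(a | T1 (Gu s) a && (a != Fx s)) (hx w a (Fx s))%:R))).
    by apply: ler_avg => w; apply: (pick_err _ _ (h := hx w)); rewrite /hx !eqxx.
  rewrite avgD avg_cst// avg_sum lerD2l.
  rewrite (eq_bigr (fun=> (ms%:R * m1%:R)^-1)) => [|a /andP[_ /Hx] //].
  rewrite sumr_const -[_^-1 *+ _]mulr_natl ler_wpM2r ?invr_ge0 ?mulr_ge0//.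
  apply: le_trans (card1 (Gu s)); rewrite ler_nat; apply: subset_leq_card.
  by apply/fintype.subsetP => a; rewrite /in_mem /= => /andP[].
have Ay : avg (fun w => prob P (ey w)) <= prob P (fun s => ~~ T2 (Gv s) (Fy s)) +
    (K2 / (ms%:R * mt%:R * m2%:R) + K3 / (mt%:R * m2%:R)).
  apply: avgP => s /suppP phis; apply: (@le_trans _ _ (avg (fun w => (~~ T2 (Gv s)
    (Fy s))%:R +
      \sum_(c | T2 (Gv s) c && (c != Fy s)) (hy w c (Fy s))%:R))).
    apply: ler_avg => w; rewrite /ey -phis; apply: (pick_err _ _ (h := hy w)).
    by rewrite /hy !eqxx.
  rewrite avgD avg_cst// avg_sum lerD2l.
  rewrite (eq_bigr (fun c => if phi c == phi (Fy s) then (mt%:R * m2%:R)^-1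
     else (ms%:R * mt%:R * m2%:R)^-1)) => [|c /andP[_ /Hy] //].
  (* Wrong candidates with another [phi] are counted by [K2], those with the same [phi] by [K3]. *)
  rewrite (bigID (fun c => phi c == phi (Fy s))) /= addrC lerD//.
    rewrite (eq_bigr (fun=> (ms%:R * mt%:R * m2%:R)^-1)) => [|c /andP[_ /negPf ->] //].
    rewrite sumr_const -[_^-1 *+ _]mulr_natl ler_wpM2r ?invr_ge0 ?mulr_ge0//.
    apply: le_trans (card2 (Gv s)); rewrite ler_nat; apply: subset_leq_card.
    by apply/fintype.subsetP => c; rewrite /in_mem /= => /andP[/andP[]].
  rewrite (eq_bigr (fun=> (mt%:R * m2%:R)^-1)) => [|c /andP[_ ->] //].
  rewrite sumr_const -[_^-1 *+ _]mulr_natl ler_wpM2r ?invr_ge0 ?mulr_ge0//.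
  apply: le_trans (card3 (Gv s) (phi (Fy s))); rewrite ler_nat; apply: subset_leq_card.
  by apply/fintype.subsetP => c; rewrite /in_mem /= => /andP[/andP[-> _] ->].
have := lerD Ax Ay; rewrite -avgD => /(avg_exists Om0) [w Hw].
by exists w.1.1.1, w.1.1.2, w.1.2, w.2, (dx w), (dy w).
Qed.

End OneShot.

(** * Bin counts and achievability of the cut-set region *)

Section Bins.
Variable R : realType.

(** The successor keeps the bin set inhabited and its size above [2 ^ (n * x)]; for [x >= 0] it
    costs at most one bit. *)
Definition bins (n : nat) (x : R) : nat := (Num.truncn (2 `^ (n%:R * x))).+1.

Lemma bins_ge n x : 2 `^ (n%:R * x) <= (bins n x)%:R.
Proof. exact/ltW/truncnS_gt. Qed.

Lemma log2_bins n x : 0 <= x -> log2 ((bins n x)%:R : R) <= n%:R * x + 1.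
Proof.
move=> x0; rewrite -le_powR2 ?ltr0n// powR2D powRr1//.
have h1 : 1 <= 2 `^ (n%:R * x) :> R.
  by rewrite -[leLHS](powRr0 2) ler_powR ?mulr_ge0// ler1n.
have := truncn_le (2 `^ (n%:R * x) : R); rewrite powR_ge0 => h2.
by rewrite /bins -natr1 mulr_natr mulr2n lerD// h2.
Qed.

Lemma powR2_small (d e : R) : 0 < d -> 0 < e ->
  exists N, forall n, (N <= n)%N -> 2 `^ (- (n%:R * d)) <= e.
Proof.
move=> d0 e0; exists (Num.truncn (`|log2 e| / d)).+1 => n nN.
rewrite -(ler_log2 (powR2_gt0 _) e0) log2_powR lerNl.
have : `|log2 e| <= n%:R * d.
  rewrite -ler_pdivrMr//; apply: (@le_trans _ _ (Num.truncn (`|log2 e| / d)).+1%:R).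
    exact/ltW/truncnS_gt.
  by rewrite ler_nat.
by apply: le_trans; rewrite -normrN ler_norm.
Qed.

End Bins.

Section CondEntropy.
Variables (R : realType) (T : finType) (P : {ffun T -> R}).
Hypothesis pmfP : is_pmf P.

Lemma cond_entropy_ge0 (A B : finType) (f : T -> A) (g : T -> B)
  : 0 <= cond_entropy P f g.
Proof.
rewrite cond_entropyE//; apply: sumr_ge0 => t _.
have [->|Pt] := eqVneq (P t) 0; first by rewrite mul0r.
rewrite mulr_ge0 ?(is_pmf_ge0 pmfP)// oppr_ge0 /log2 pmulr_lle0 ?invr_gt0 ?ln2_gt0//.
apply: ln_le0. apply: le_trans (sum_cprob P f g (g t)).
by rewrite (bigD1 (f t)) //= lerDl; apply: sumr_ge0 => a _; exact: cprob_ge0.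
Qed.

Lemma card_cprob_powR (A B : finType) (f : T -> A) (g : T -> B) b (x : R) :
  #|[pred a | 2 `^ (- x) <= cprob P f g a b]|%:R <= 2 `^ x :> R.
Proof.
have := card_cprob pmfP f g b (2 `^ (- x)).
by rewrite powRN -ler_pdivlMr ?invr_gt0 ?powR2_gt0// div1r invrK.
Qed.

End CondEntropy.

Section Achievability.
Variables (R : realType) (X Y U V : finType) (Q : {ffun X * Y * U * V -> R}).
Variable phi : Y -> X.
Hypothesis pmfQ : is_pmf Q.
Hypothesis suppQ : forall t, Q t != 0 -> phi t.1.1.2 = t.1.1.1.
Notation T := (X * Y * U * V)%type.
Let fX (t : T) := t.1.1.1.
Let fY (t : T) := t.1.1.2.
Let fU (t : T) := t.1.2.
Let fV (t : T) := t.2.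
Let fXV (t : T) := (fX t, fV t).
Let a := cond_entropy Q fX fU.
Let b := cond_entropy Q fY fV.
Let h := cond_entropy Q fY fXV.

(** The chain rule for [H(X,Y|V)], where [X] is absorbed by [Y] because [phi] determines it on the
    support. *)
Lemma chain_YV : b = cond_entropy Q fX fV + h.
Proof.
rewrite /h /b /cond_entropy (@entropy_ker _ _ Q _ _ (fun t => (fY t, fXV t))
  (fun t => (fY t, fV t))).
  by rewrite /fXV; lra.
move=> s t /suppQ s0 /suppQ t0; rewrite /fXV /fX /fY -s0 -t0 !xpair_eqE.
by case: eqP => [->|//]; rewrite eqxx.
Qed.

Lemma binning_code (n : nat) (c : R) (ms m1 mt m2 : nat) :
  (0 < ms)%N -> (0 < m1)%N -> (0 < mt)%N -> (0 < m2)%N ->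
  let atyp (A B : finType) (f : T -> A) (g : T -> B) := prob (iid Q n) (fun s =>
    let w := cprob (iid Q n) (@smap _ _ f n) (@smap _ _ g n) (smap f s) (smap g s) in
    ~~ (2 `^ (- (n%:R * (cond_entropy Q f g + c))) <= w <=
        2 `^ (- (n%:R * (cond_entropy Q f g - c))))) in
  exists (f0 : {ffun 'I_n -> X} -> 'I_ms) (f1 : {ffun 'I_n -> X} -> 'I_m1)
    (g0 : {ffun 'I_n -> Y} -> 'I_mt) (g2 : {ffun 'I_n -> Y} -> 'I_m2)
    (dx : 'I_ms -> 'I_m1 -> {ffun 'I_n -> U} -> {ffun 'I_n -> X})
    (dy : 'I_ms -> 'I_mt -> 'I_m2 -> {ffun 'I_n -> V} -> {ffun 'I_n -> Y}),
  prob (iid Q n) (fun s => dx (f0 (seqX s)) (f1 (seqX s)) (seqU s) != seqX s) +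
  prob (iid Q n) (fun s => dy (f0 (seqX s)) (g0 (seqY s)) (g2 (seqY s)) (seqV s)
    != seqY s) <=
  atyp _ _ fX fU + 2 `^ (n%:R * (a + c)) / (ms%:R * m1%:R) +
  (atyp _ _ fY fV + atyp _ _ fY fXV +
    (2 `^ (n%:R * (b + c)) / (ms%:R * mt%:R * m2%:R) +
     2 `^ (n%:R * (h + c)) / (mt%:R * m2%:R))).
Proof.
move=> ms0 m10 mt0 m20 atyp; have pmfn := iid_pmf pmfQ n.
pose zipV (x : {ffun 'I_n -> X}) (v : {ffun 'I_n -> V}) : {ffun 'I_n -> X * V} :=
  [ffun i => (x i, v i)].
pose T1 (u : {ffun 'I_n -> U}) : pred {ffun 'I_n -> X} :=
  [pred x | 2 `^ (- (n%:R * (a + c))) <= cprob (iid Q n) (@smap _ _ fX n)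
    (@smap _ _ fU n) x u].
(* The second decoder does not observe the [X] sequence; conditional typicality given [(X, V)] is
   tested with the sequence computed from the candidate [y] by [phi]. *)
pose T2 (v : {ffun 'I_n -> V}) : pred {ffun 'I_n -> Y} :=
  [pred y | (2 `^ (- (n%:R * (b + c))) <= cprob (iid Q n) (@smap _ _ fY n)
    (@smap _ _ fV n) y v)
    && (2 `^ (- (n%:R * (h + c))) <=
        cprob (iid Q n) (@smap _ _ fY n) (@smap _ _ fXV n) y (zipV (smap phi y) v))].
have supp s : iid Q n s != 0 -> smap phi (smap fY s) = smap fX s.
  move=> s0; apply/ffunP => i; rewrite !ffunE; apply: suppQ; exact: iid_supp s0.
have k1 u : #|T1 u|%:R <= 2 `^ (n%:R * (a + c)) :> R by exact: card_cprob_powR.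
have k2 v : #|T2 v|%:R <= 2 `^ (n%:R * (b + c)) :> R.
  apply: le_trans (card_cprob_powR pmfn (@smap _ _ fY n) (@smap _ _ fV n) v _).
  by rewrite ler_nat; apply: subset_leq_card; apply/fintype.subsetP => y;
    rewrite !inE => /andP[].
(* Fixing the image of [y] under [phi] fixes the conditioning sequence, so the exponent is
   [H(Y|X,V)]. *)
have k3 v x : #|[pred y | T2 v y && (smap phi y == x)]|%:R <= 2 `^ (n%:R * (h + c)) :> R.
  apply: le_trans (card_cprob_powR pmfn (@smap _ _ fY n) (@smap _ _ fXV n) (zipV x v) _).
  rewrite ler_nat; apply: subset_leq_card; apply/fintype.subsetP => y; rewrite !inE.
  by move=> /andP[/andP[_ h3] /eqP <-].
have [f0 [f1 [g0 [g2 [dx [dy H]]]]]] := oneshot_binning (Fx := @smap _ _ fX n)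
  (Fy := @smap _ _ fY n)
  (@smap _ _ fU n) (@smap _ _ fV n) pmfn supp k1 k2 k3 ms0 m10 mt0 m20.
exists f0, f1, g0, g2, dx, dy; apply: le_trans H _.
apply: lerD; apply: lerD => //.
  by apply: prob_le => // s _ /=; apply: contra => /andP[].
apply: le_trans (probU pmfn _ _); apply: prob_le => // s s0 /=.
rewrite -negb_and; apply: contra => /andP[/andP[h1 _] /andP[h2 _]].
rewrite /T2 /= h1 /= supp//.
suff -> : zipV (smap fX s) (smap fV s) = smap fXV s by [].
by apply/ffunP => i; rewrite !ffunE.
Qed.

Hypothesis degraded : a <= cond_entropy Q fX fV.

Lemma cutset_sub_achievable : (cutset a b `<=` achievable_region Q)%classic.
Proof.
move=> [[r0 r1] r2] [/= r00 r10 r20 ha hb] eps eps0.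
(* Three atypicality terms and three collision terms give error at most [6 * c]. The common message
   consists of two bin indices, with excess rate [4 * c + 2 / n], which is at most [eps] when
   [n >= 4 / eps]. *)
pose c := eps / 8; have c0 : 0 < c by rewrite divr_gt0.
have [N1 HN1] := aep pmfQ fX fU c0 c0.
have [N2 HN2] := aep pmfQ fY fV c0 c0.
have [N3 HN3] := aep pmfQ fY fXV c0 c0.
have [N4 HN4] := powR2_small c0 c0.
pose N5 := (Num.truncn (4 / eps)).+1.
exists (maxn N1 (maxn N2 (maxn N3 (maxn N4 N5)))) => n.
rewrite !geq_max => /and5P[/HN1 e1 /HN2 e2 /HN3 e3 /HN4 e4 n5].
have {n5} n5 : 4 / eps <= n%:R.
  by apply: (@le_trans _ _ N5%:R); [exact/ltW/truncnS_gt|rewrite ler_nat].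
have n0 : 0 < n%:R :> R by apply: lt_le_trans n5; rewrite divr_gt0.
have a0 : 0 <= a by exact: cond_entropy_ge0.
pose s := Num.min r0 a; pose t := r0 - s.
have s0 : 0 <= s by rewrite le_min r00.
have t0 : 0 <= t by rewrite subr_ge0 ge_min lexx.
have sr1 : a <= s + r1 by rewrite /s; case: (leP r0 a) => _ //; lra.
have tr2 : h <= t + r2.
  (* Degradedness gives [h <= b - a], and [b <= r0 + r2] with [s <= a] bounds this by [t + r2]. *)
  have : s <= a by rewrite ge_min lexx orbT.
  by move: (chain_YV) degraded hb; rewrite /t; lra.
(* One [c] offsets the excess in the exponent of the list size; the other makes each ratio at most
   [2 ^ (- n * c)], hence at most [c]. *)
pose ms := bins n (s + 2 * c); pose m1 := bins n (r1 + 2 * c).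
pose mt := bins n (t + 2 * c); pose m2 := bins n (r2 + 2 * c).
have [f0 [f1 [g0 [g2 [dx [dy]]]]]] :=
  @binning_code n c ms m1 mt m2 (ltn0Sn _) (ltn0Sn _) (ltn0Sn _) (ltn0Sn _).
move=> /= H.
(* Message sets are ordinals, so the pair of bins forming [M0] is numbered by [enum_rank]. *)
exists #|{: 'I_ms * 'I_mt}|, m1, m2,
  (fun xs ys => (enum_rank (f0 xs, g0 ys), f1 xs, g2 ys)),
  (fun i j us => dx (enum_val i).1 j us), (fun i k vs => dy (enum_val i).1 (enum_val
    i).2 k vs).
have ratio x y z : 0 < y -> 2 `^ (n%:R * z) <= y -> x + c <= z -> 2 `^ (n%:R * x)
  / y <= c.
  move=> y0 yz xz; apply: le_trans e4; rewrite ler_pdivrMr//.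
  apply: le_trans (ler_wpM2l (powR_ge0 _ _) yz); rewrite -powR2D ler_powR ?ler1n//.
  by rewrite addrC -mulrBr ler_pM2l//; lra.
have bgt m x : 0 < (bins m x)%:R :> R by rewrite ltr0n.
have E1 : 2 `^ (n%:R * (a + c)) / (ms%:R * m1%:R) <= c.
  apply: (ratio _ _ ((s + 2 * c) + (r1 + 2 * c))); first by rewrite mulr_gt0.
    by rewrite mulrDr powR2D ler_pM ?powR_ge0 ?bins_ge.
  by lra.
have E2 : 2 `^ (n%:R * (b + c)) / (ms%:R * mt%:R * m2%:R) <= c.
  apply: (ratio _ _ ((s + 2 * c) + (t + 2 * c) + (r2 + 2 * c)));
    first by rewrite !mulr_gt0.
    by do 2 (rewrite mulrDr powR2D; apply: ler_pM; rewrite ?powR_ge0 ?bins_ge//).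
  by rewrite /t; lra.
have E3 : 2 `^ (n%:R * (h + c)) / (mt%:R * m2%:R) <= c.
  apply: (ratio _ _ ((t + 2 * c) + (r2 + 2 * c))); first by rewrite mulr_gt0.
    by rewrite mulrDr powR2D ler_pM ?powR_ge0 ?bins_ge.
  by lra.
have rate x y : 0 <= x -> y <= n%:R * (x + 2 * c) + 1 -> y / n%:R <= x + eps.
  move=> x0 yx; rewrite ler_pdivrMr//; apply: le_trans yx _.
  by move: n5; rewrite ler_pdivrMr// /c; nra.
have pos x : 0 <= x -> 0 <= x + 2 * c by lra.
split => /=.
- rewrite !iid_probE ge_max; apply/andP; split.
    rewrite (_ : prob _ _ = prob (iid Q n) (fun s => dx (f0 (seqX s)) (f1 (seqX s))
      (seqU s) != seqX s)).
      apply: (@le_trans _ _ (6 * c)); last by rewrite /c; lra.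
      have : 0 <= prob (iid Q n) (fun s => dy (f0 (seqX s)) (g0 (seqY s))
        (g2 (seqY s)) (seqV s) != seqY s).
        by apply: sumr_ge0 => ? _; exact: (iid_pmf pmfQ n).1.
      by move: H e1 e2 e3 E1 E2 E3; rewrite -/a -/b -/h; lra.
    by apply: eq_bigl => x; rewrite enum_rankK.
  rewrite (_ : prob _ _ = prob (iid Q n) (fun s => dy (f0 (seqX s)) (g0 (seqY s))
    (g2 (seqY s)) (seqV s) != seqY s)).
    apply: (@le_trans _ _ (6 * c)); last by rewrite /c; lra.
    have : 0 <= prob (iid Q n) (fun s => dx (f0 (seqX s)) (f1 (seqX s)) (seqU s)
      != seqX s).
      by apply: sumr_ge0 => ? _; exact: (iid_pmf pmfQ n).1.
    by move: H e1 e2 e3 E1 E2 E3; rewrite -/a -/b -/h; lra.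
  by apply: eq_bigl => x; rewrite enum_rankK.
- rewrite card_prod !card_ord natrM log2M// ler_pdivrMr//.
  have := log2_bins n (pos _ s0); have := log2_bins n (pos _ t0).
  move: n5; rewrite ler_pdivrMr// -/ms -/mt.
  move: (log2 _) (log2 _) => L1 L2 n5 l1 l2.
  apply: le_trans (lerD l2 l1) _.
  by rewrite /t /c; nra.
- by apply: rate => //; exact: log2_bins (pos _ r10).
- by apply: rate => //; exact: log2_bins (pos _ r20).
Qed.

End Achievability.

(** * Degraded side information *)

Section Markov.
Variables (R : realType).

(** The Markov identity gives [H(f|g) = H(f|g,h)], and removing [g] from the conditioning can only
    increase entropy. *)
Lemma markov_cond_entropy (T A B C : finType) (P : {ffun T -> R}) (f : T -> A)
  (g : T -> B)
    (h : T -> C) : is_pmf P ->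
  (forall t, marg P (fun s => (f s, g s, h s)) (f t, g t, h t) * marg P g (g t) =
     marg P (fun s => (f s, g s)) (f t, g t) * marg P (fun s => (g s, h s)) (g t, h t)) ->
  cond_entropy P f g <= cond_entropy P f h.
Proof.
move=> pmfP mk; have S := entropy_submod pmfP f g h.
suff E : cond_entropy P f g =
    entropy P (fun t => (f t, g t, h t)) - entropy P (fun t => (g t, h t)).
  by rewrite E /cond_entropy; lra.
rewrite /cond_entropy !entropyB; apply: eq_bigr => t _.
have [->|Pt] := eqVneq (P t) 0; first by rewrite !mul0r.
have := congr1 log2 (mk t).
have p1 := marg_gt0 pmfP (fun s => (f s, g s, h s)) Pt.
have p2 := marg_gt0 pmfP g Pt.
have p3 := marg_gt0 pmfP (fun s => (f s, g s)) Pt.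
have p4 := marg_gt0 pmfP (fun s => (g s, h s)) Pt.
by rewrite !log2M// => e; congr (_ * _); lra.
Qed.

Variables (X Z U V : finType) (Q : {ffun X * Z * U * V -> R}).

(** Both sides of the Markov identity for [(X,Z)] are summed over [z]. *)
Lemma markov_XUV x u v : markov_XZ_U_V Q ->
  marg Q (fun t => (t.1.1.1, t.1.2, t.2)) (x, u, v) * marg Q (fun t => t.1.2) u =
  marg Q (fun t => (t.1.1.1, t.1.2)) (x, u) * marg Q (fun t => (t.1.2, t.2)) (u, v).
Proof.
move=> mk.
have -> : marg Q (fun t => (t.1.1.1, t.1.2, t.2)) (x, u, v) = \sum_z Q (x, z, u, v).
  rewrite /marg (reindex_onto (fun z => (x, z, u, v)) (fun t => t.1.1.2)) /=.
    by apply: eq_bigl => z; rewrite !eqxx.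
  by move=> [[[x' z'] u'] v'] /eqP [-> -> ->].
rewrite -(sum_marg_pair Q (fun t => t.1.1.2) (fun t => (t.1.1.1, t.1.2)))
  !mulr_suml; apply: eq_bigr => z _.
rewrite (mk (x, z, u, v)) /=; congr (_ * _); apply: eq_bigl => t /=.
by case: t => -[[x' z'] u'] v' /=; rewrite !xpair_eqE; do !case: (_ == _).
Qed.

Definition embed_Y (q : X * Z * U * V) : X * (X * Z) * U * V :=
  (q.1.1.1, (q.1.1.1, q.1.1.2), q.1.2, q.2).

(** The lifted law vanishes unless the two copies of [X] agree, and [embed_Y] parametrizes the
    points where they do. *)
Lemma sum_lift (p : pred (X * (X * Z) * U * V)) :
  \sum_(t | p t) lift_Y Q t = \sum_(q | p (embed_Y q)) Q q.
Proof.
rewrite (bigID (fun t => t.1.1.2.1 == t.1.1.1)) /= [X in _ + X]big1 ?addr0; last first.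
  by move=> t /andP[_ /negPf nt]; rewrite ffunE nt.
rewrite (reindex_onto embed_Y (fun t => (t.1.1.1, t.1.1.2.2, t.1.2, t.2))) /=; last first.
  by move=> [[[x [x' z]] u] v] /= /andP[_ /eqP ->].
apply: eq_big => [[[[x z] u] v]|[[[x z] u] v] _]; first by rewrite !eqxx !andbT.
by rewrite ffunE /= eqxx.
Qed.

Lemma lift_pmf : is_pmf Q -> is_pmf (lift_Y Q).
Proof.
move=> [Q0 Q1]; split=> [t|]; first by rewrite ffunE; case: ifP.
by rewrite sum_lift.
Qed.

Lemma marg_lift (A : eqType) (f : X * (X * Z) * U * V -> A) c :
  marg (lift_Y Q) f c = marg Q (f \o embed_Y) c.
Proof. exact: sum_lift. Qed.

End Markov.

Theorem theorem5 (R : realType) (X Z U V : finType)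
  (Q : {ffun X * Z * U * V -> R}) :
  is_pmf Q -> markov_XZ_U_V Q ->
  achievable_region (lift_Y Q) = closure (Rout_union (lift_Y Q)).
Proof.
move=> /lift_pmf pmfL mk.
rewrite (Rout_union_cutset pmfL).
(* The union is the cut-set region, cut out by non-strict inequalities between continuous functions,
   so it is its own closure. *)
rewrite -(closure_id _).1; last exact: closed_cutset.
apply/seteqP; split; first exact: achievable_sub_cutset.
(* As [Y = (X, Z)], the first projection recovers [X] from [Y]. *)
apply: (cutset_sub_achievable (phi := fst)) => // [t|].
  by rewrite ffunE; case: (t.1.1.2.1 =P t.1.1.1) => // _; rewrite eqxx.
apply: markov_cond_entropy => // t; rewrite !marg_lift.
exact: markov_XUV.
Qed.
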